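(* Let $I$ be a non-empty set, let $\varphi\colon[0,\infty)\to[0,\infty)$ be an Orlicz function and let $E=h_\varphi(I)$ be the Orlicz heart (over counting measure on $I$), equipped with the Luxemburg norm $$\|x\|_\varphi:=\inf\Bigl\{\lambda>0:\ \sum_{i\in I}\varphi\bigl(|x_i|/\lambda\bigr)\le1\Bigr\},$$ where $\sum_{i\in I}$ denotes the supremum of finite subsums. Let $\varphi^{-1}(s):=\inf\{t\ge0:\varphi(t)\ge s\}$ for $s\ge0$. Then: (a) For each $i\in I$, $\|\delta_i\|_\varphi=1/\varphi^{-1}(1)$. (b) More generally, for every finite set $F\subseteq I$ with $|F|=n$, $n\in\{1,2,\dots\}$, $$\|\chi_F\|_\varphi=\frac{1}{\varphi^{-1}(1/n)}.$$ Consequently, if $I$ is infinite, $$C_E=\sup_{F\subseteq I,\ |F|<\infty}\|\chi_F\|_\varphi=\sup_{n\in\{1,2,\dots\}}\frac{1}{\varphi^{-1}(1/n)}\in(0,\infty].$$ (c) Assume that $I$ is infinite. Then $C_E<\infty$ if and only if $\varphi$ vanishes on a neighbourhood of $0$, i.e. $a_\varphi:=\sup\{t\ge0:\varphi(t)=0\}>0$. In that case $C_E=1/a_\varphi$. If $\varphi(t)>0$ for all $t>0$ (in particular, for any $N$-function), then $C_E=+\infty$.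
   Context: An Orlicz function is, as usual, a convex, continuous, non-decreasing function $\varphi\colon[0,\infty)\to[0,\infty)$ with $\varphi(0)=0$ and $\varphi(t)\to\infty$ as $t\to\infty$ (it may vanish on an interval $[0,a]$). The Orlicz heart $h_\varphi(I)$ is the closure of $c_{00}(I)$ (the finitely supported complex functions on $I$) in the Orlicz sequence space $\ell_\varphi(I)=\{x\in\mathbb{C}^I:\|x\|_\varphi<\infty\}$ for the norm $\|\cdot\|_\varphi$. $\chi_F$ is the characteristic function of $F\subseteq I$, $\delta_i=\chi_{\{i\}}$, and $C_E:=\sup\{\|\chi_F\|_E: F\subseteq I\text{ finite}\}$, here computed with $\|\cdot\|_E=\|\cdot\|_\varphi$. *)

(* Defs.v *)
From HB Require Import structures.
From mathcomp Require Import all_boot all_order all_algebra.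
From mathcomp Require Import all_classical all_reals all_analysis.
From mathcomp Require Export complex.

Set Implicit Arguments.
Unset Strict Implicit.
Unset Printing Implicit Defensive.

Import Order.TTheory GRing.Theory Num.Theory.
Import numFieldNormedType.Exports ComplexField.

Local Open Scope classical_set_scope.
Local Open Scope ring_scope.

(* A function [0, oo) -> [0, oo) is represented by a total [phi : R -> R];
   its values at negative arguments are never constrained nor used. *)
Record Orlicz_function (R : realType) (phi : R -> R) : Prop := {
  orlicz_ge0 : forall t, 0 <= t -> 0 <= phi t ;
  orlicz_convex : convex_function (`[0, +oo[ : set R) phi ;
  orlicz_continuous : {within `[0, +oo[, continuous phi} ;
  orlicz_nondecreasing : {in `[0, +oo[ &, {homo phi : s t / s <= t}} ;
  orlicz0 : phi 0 = 0 ;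
  orlicz_cvgy : phi t @[t --> +oo] --> +oo }.

Record N_function (R : realType) (phi : R -> R) : Prop := {
  N_function_orlicz : Orlicz_function phi ;
  N_function_gt0 : forall t, 0 < t -> 0 < phi t ;
  N_function_cvg0 : phi t / t @[t --> 0^'+] --> 0 ;
  N_function_cvgy : phi t / t @[t --> +oo] --> +oo }.

Definition luxemburg (R : realType) (I : choiceType) (phi : R -> R)
    (x : I -> R[i]) : \bar R :=
  ereal_inf [set l%:E | l in [set l : R | 0 < l /\
    (\esum_(i in [set: I]) (phi (Normc.normc (x i) / l))%:E <= 1)%E]].

Definition orlicz_space (R : realType) (I : choiceType) (phi : R -> R) :
    set (I -> R[i]) :=
  [set x | (luxemburg phi x < +oo)%E].

Definition c00 (R : realType) (I : choiceType) : set (I -> R[i]) :=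
  [set x | finite_set [set i | x i != 0]].

Definition orlicz_heart (R : realType) (I : choiceType) (phi : R -> R) :
    set (I -> R[i]) :=
  [set x | orlicz_space phi x /\
    forall e : R, 0 < e ->
      exists2 y, c00 y & (luxemburg phi (fun i => x i - y i)%R < e%:E)%E].

Definition char_const (R : realType) (I : choiceType) (E : set (I -> R[i]))
    (normE : (I -> R[i]) -> \bar R) : \bar R :=
  ereal_sup [set normE \1_F | F in [set F | finite_set F /\ E \1_F]].

Lemma orlicz_le_scale (R : realType) (phi : R -> R) (u l : R) :
  Orlicz_function phi -> 0 <= u -> 1 <= l -> phi (u / l) <= phi u / l.
Proof.
move=> phiO u0 l1; have l0 : 0 < l by apply: lt_le_trans l1.
have li01 : 0 <= l^-1 <= 1 by rewrite invr_ge0 ltW// invf_le1.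
have [li0 li1] := andP li01.
pose t : {i01 R} := Itv01 li0 li1.
have := orlicz_convex phiO t (x := u) (y := 0).
rewrite !inE/= !in_itv/= !andbT lexx u0 => /(_ isT isT) phiconv.
have {}phiconv : phi (l^-1 * u + (1 - l^-1) * 0) <=
    l^-1 * phi u + (1 - l^-1) * phi 0 by exact: phiconv.
by move: phiconv; rewrite (orlicz0 phiO) !mulr0 !addr0 ![l^-1 * _]mulrC.
Qed.

Lemma luxemburg_le (R : realType) (I : choiceType) (phi : R -> R)
    (x : I -> R[i]) (l : R) : 0 < l ->
  (\esum_(i in [set: I]) (phi (Normc.normc (x i) / l))%:E <= 1)%E ->
  (luxemburg phi x <= l%:E)%E.
Proof. by move=> l0 xl; apply: ereal_inf_lbound; exists l. Qed.

Lemma normc_ge0 (R : realType) (z : R[i]) : 0 <= Normc.normc z.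
Proof. by case: z => a b; exact: sqrtr_ge0. Qed.

Lemma c00_orlicz_heart (R : realType) (I : choiceType) (phi : R -> R) :
  Orlicz_function phi -> c00 (R := R) (I := I) `<=` orlicz_heart phi.
Proof.
move=> phiO x fx; split; last first.
  move=> e e0; exists x => //.
  apply: (@le_lt_trans _ _ (e / 2)%:E); last first.
    by rewrite lte_fin ltr_pdivrMr// ltr_pMr// ltr1n.
  apply: luxemburg_le; first by rewrite divr_gt0.
  rewrite esum1// => i _.
  by rewrite subrr Normc.normc0 mul0r (orlicz0 phiO).
set A := [set i | x i != 0] in fx.
pose S := \sum_(i \in A) phi (Normc.normc (x i)).
have phi0 i : 0 <= phi (Normc.normc (x i)).
  by apply: (orlicz_ge0 phiO); exact: normc_ge0.
have S0 : 0 <= S by rewrite /S fsbig_finite//=; apply: sumr_ge0.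
have l1 : 1 <= 1 + S by rewrite lerDl.
have l0 : 0 < 1 + S by apply: lt_le_trans l1.
apply: (@le_lt_trans _ _ (1 + S)%:E); last exact: ltry.
apply: luxemburg_le => //.
have phil0 i : 0 <= phi (Normc.normc (x i) / (1 + S)).
  by apply: (orlicz_ge0 phiO); rewrite divr_ge0 ?normc_ge0// ltW.
rewrite (esumID A)//; last by move=> i _; rewrite lee_fin.
rewrite !setTI.
rewrite [X in (_ + X)%E]esum1 ?adde0; last first.
  move=> i /= /negP; rewrite negbK => /eqP ->.
  by rewrite Normc.normc0 mul0r (orlicz0 phiO).
rewrite esum_fset//; last by move=> i _; rewrite lee_fin.
apply: (@le_trans _ _ (S / (1 + S))%:E); last first.
  by rewrite lee_fin ler_pdivrMr// mul1r lerDr.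
rewrite fsbig_finite//= sumEFin lee_fin.
rewrite {2}/S fsbig_finite//= mulr_suml; apply: ler_sum => i _.
by apply: orlicz_le_scale => //; exact: normc_ge0.
Qed.

Lemma indic_orlicz_heart (R : realType) (I : choiceType) (phi : R -> R)
    (F : set I) :
  Orlicz_function phi -> finite_set F -> orlicz_heart phi (\1_F : I -> R[i]).
Proof.
move=> phiO finF; apply: c00_orlicz_heart => //.
apply: sub_finite_set finF => i /=; rewrite indicE.
by case: (boolP (i \in F)) => [/set_mem//|_]; rewrite eqxx.
Qed.

Definition orlicz_inv (R : realType) (phi : R -> R) (s : R) : R :=
  inf [set t | 0 <= t /\ s <= phi t].

Definition orlicz_a (R : realType) (phi : R -> R) : R :=
  sup [set t | 0 <= t /\ phi t = 0].

(* Main.v *)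
(* For s > 0 continuity and convexity make phi^{-1}(s) the only point where phi
   takes the value s, so {phi <= s} = [0, phi^{-1}(s)].  As the modular of
   chi_F / l is |F| phi(1/l), this gives ||chi_F|| = 1 / phi^{-1}(1/|F|), and
   C_E <= 1/u holds exactly when phi(u) <= 1/n for every n, i.e. phi(u) = 0. *)
Require Import Defs.
From mathcomp Require Import all_boot all_order all_algebra.
From mathcomp Require Import all_classical all_reals all_analysis.
From mathcomp Require Import complex.

Set Implicit Arguments.
Unset Strict Implicit.
Unset Printing Implicit Defensive.

Import Order.TTheory GRing.Theory Num.Theory.
Import numFieldNormedType.Exports ComplexField.

Local Open Scope classical_set_scope.
Local Open Scope ring_scope.

(** Convexity and [phi 0 = 0] make [phi] grow at least linearly along rays from [0], so a positive
    level [s] is crossed strictly, even if [phi] vanishes near [0]. Later inequalities [phi t <= s]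
    thus turn into bounds on [t]. *)
Lemma orlicz_inv_level (R : realType) (phi : R -> R) (s : R) :
  Orlicz_function phi -> 0 < s ->
  0 < orlicz_inv phi s /\
  forall t, 0 <= t -> (phi t <= s) = (t <= orlicz_inv phi s).
Proof.
move=> phiO s0.
have [b [b0 sb]] : exists b, 0 <= b /\ s <= phi b.
  have /cvgryPge/(_ s) hs := orlicz_cvgy phiO.
  near (pinfty_nbhs R) => b; exists b; split; near: b => //.
  exact: nbhs_pinfty_ge.
have phi_b : {within `[0, b], continuous phi}.
  apply: continuous_subspaceW (orlicz_continuous phiO).
  by move=> x /=; rewrite !in_itv/= => /andP[->].
have [|t0 t0b t0s] := IVT (v := s) b0 phi_b.
  rewrite (orlicz0 phiO) ge_min le_max sb orbT andbT.
  by rewrite (ltW s0).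
have t0_gt0 : 0 < t0.
  move: t0b; rewrite in_itv/= le_eqVlt => /andP[/orP[/eqP t00|//] _].
  by move: s0; rewrite -t0s -t00 (orlicz0 phiO) ltxx.
(* For [t > 0], scaling [t0] down by [t0 / t] gives [phi t <= s * t / t0 < s]. *)
have below t : 0 <= t -> t < t0 -> phi t < s.
  move=> t_ge0 tt0; case: (ltgtP t 0) t_ge0 => // [t_gt0|->] _; last first.
    by rewrite (orlicz0 phiO).
  have l1 : 1 <= t0 / t by rewrite ler_pdivlMr// mul1r ltW.
  have := orlicz_le_scale phiO (ltW t0_gt0) l1.
  rewrite invf_div mulrCA divff ?gt_eqF// mulr1 t0s => /le_lt_trans; apply.
  by rewrite mulrA ltr_pdivrMr// ltr_pM2l.
(* Scaling [t] down to [t0] gives [s = phi t0 <= phi t * t0 / t], hence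
   [phi t >= s * t / t0 > s]. *)
have above t : t0 < t -> s < phi t.
  move=> tt0; have t_gt0 := lt_trans t0_gt0 tt0.
  have l1 : 1 <= t / t0 by rewrite ler_pdivlMr// mul1r ltW.
  have := orlicz_le_scale phiO (ltW t_gt0) l1.
  rewrite invf_div mulrCA divff ?gt_eqF// mulr1 t0s.
  rewrite mulrA ler_pdivlMr// -(ltr_pM2r t0_gt0); apply: lt_le_trans.
  by rewrite ltr_pM2l.
have -> : orlicz_inv phi s = t0.
  apply/eqP; rewrite eq_le; apply/andP; split.
    apply: ge_inf; first by exists 0 => t [].
    by split; [exact: ltW|rewrite t0s].
  apply: lb_le_inf; first by exists t0; split; [exact: ltW|rewrite t0s].
  move=> t [t_ge0 st]; rewrite leNgt; apply/negP => /(below _ t_ge0).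
  by rewrite ltNge st.
split=> // t t_ge0; have [tt0|tt0|->] := ltgtP t t0.
- by rewrite ltW// below.
- by rewrite leNgt above.
- by rewrite t0s lexx.
Unshelve. all: by end_near. Qed.

Lemma luxemburg_indic (R : realType) (I : choiceType) (phi : R -> R)
    (F : set I) (n : nat) :
  Orlicz_function phi -> (0 < n)%N -> (F #= `I_n)%card ->
  luxemburg phi (\1_F : I -> R[i]) = (1 / orlicz_inv phi (1 / n%:R))%:E.
Proof.
move=> phiO n0 Fn.
have n_gt0 : 0 < n%:R :> R by rewrite ltr0n.
have finF : finite_set F by apply/finite_setP; exists n.
have [m0 mP] : _ /\ _ := orlicz_inv_level phiO (divr_gt0 ltr01 n_gt0).
set m := orlicz_inv _ _ in m0 mP *.
have modE l : 0 < l ->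
    (\esum_(i in [set: I]) (phi (Normc.normc ((\1_F : I -> R[i]) i) / l))%:E
      = (n%:R * phi (1 / l))%:E)%E.
  move=> l0; transitivity (\esum_(i in F) (phi (1 / l))%:E)%E.
    rewrite [RHS]esum_mkcond; apply: eq_esum => i _; rewrite indicE.
    case: ifP => _.
      by rewrite Normc.normc1.
    by rewrite Normc.normc0 mul0r (orlicz0 phiO).
  rewrite esum_fset//; last first.
    by move=> i _; rewrite lee_fin (orlicz_ge0 phiO)// divr_ge0 ?ltW.
  rewrite fsbig_finite//= sumEFin big_const_seq count_predT.
  by rewrite (card_fset_set Fn) iter_addr_0 mulr_natl.
(* By the level lemma at [1 / n], the condition means [1 / l <= m]. The admissible [l] form the ray
   from [1 / m] on, so the infimum is attained. *)
have admissible l : 0 < l -> (n%:R * phi (1 / l) <= 1) = (1 / m <= l).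
  move=> l0; rewrite mulrC -ler_pdivlMr// mP; last first.
    by rewrite divr_ge0 ?ltW.
  by rewrite ler_pdivrMr// ler_pdivrMr// mulrC.
apply/eqP; rewrite eq_le; apply/andP; split.
  have l0 : 0 < 1 / m by rewrite divr_gt0.
  by apply: luxemburg_le => //; rewrite modE// lee_fin admissible.
apply: le_ereal_inf_tmp => _ [l [l0 +] <-].
by rewrite modE// !lee_fin admissible.
Qed.

(** The modular of the zero function vanishes, so every [l > 0] is admissible. This covers the
    finite set that the formula for [0 < n] leaves out. *)
Lemma luxemburg_indic0 (R : realType) (I : choiceType) (phi : R -> R) :
  Orlicz_function phi -> luxemburg phi (\1_set0 : I -> R[i]) = 0%E.
Proof.
move=> phiO; apply/eqP; rewrite eq_le; apply/andP; split; last first.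
  by apply: le_ereal_inf_tmp => _ [l [l0 _] <-]; rewrite lee_fin ltW.
apply/lee_addgt0Pr => e e0; rewrite add0e; apply: luxemburg_le => //.
rewrite esum1// => i _.
by rewrite indicE in_set0 Normc.normc0 mul0r (orlicz0 phiO).
Qed.

Lemma char_const_orlicz_heart (R : realType) (I : choiceType) (phi : R -> R) :
  Orlicz_function phi ->
  char_const (orlicz_heart phi : set (I -> R[i])) (luxemburg phi) =
  ereal_sup [set luxemburg phi (\1_F : I -> R[i]) |
             F in [set F | finite_set F]].
Proof.
move=> phiO; congr ereal_sup; apply/seteqP; split=> _ [F /= + <-].
  by move=> [finF _]; exists F.
by move=> finF; exists F => //; split=> //; exact: indic_orlicz_heart.
Qed.

Lemma char_const_orlicz_inv (R : realType) (I : choiceType) (phi : R -> R) :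
  Orlicz_function phi -> infinite_set [set: I] ->
  char_const (orlicz_heart phi : set (I -> R[i])) (luxemburg phi) =
  ereal_sup [set (1 / orlicz_inv phi (1 / n%:R))%:E |
             n in [set n : nat | (0 < n)%N]].
Proof.
move=> phiO infI; rewrite char_const_orlicz_heart//.
(* An infinite [I] contains a copy of the natural numbers, so every index [n] is realised by some
   [F]. *)
have sub_card n : exists F : set I, (F #= `I_n)%card.
  have /infiniteP natI := infI.
  have /card_subP[F Fn _] : (`I_n #<= [set: I])%card.
    by apply: card_le_trans natI; exact: card_leT.
  by exists F.
apply/eqP; rewrite eq_le; apply/andP; split.
  apply: ge_ereal_sup => _ [F /finite_setP[[|n] Fn] <-].
    (* The empty set contributes the norm [0], which lies below the term for [n = 1]. *)
    move: Fn; rewrite II0 card_eq0 => /eqP ->; rewrite luxemburg_indic0//.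
    apply: le_trans (ereal_sup_ubound _); last by exists 1%N.
    have [m0 _] := orlicz_inv_level phiO (divr_gt0 ltr01 (ltr0Sn R 0)).
    by rewrite lee_fin divr_ge0 ?ltW.
  by apply: ereal_sup_ubound; exists n.+1 => //; rewrite (luxemburg_indic phiO _ Fn).
apply: ge_ereal_sup => _ [n n0 <-]; have [F Fn] := sub_card n; apply: ereal_sup_ubound.
exists F; last exact: luxemburg_indic.
by apply/finite_setP; exists n.
Qed.

(* [C_E <= 1/u] says [u <= phi^{-1}(1/n)], i.e. [phi u <= 1/n], for all [n]. *)
Lemma char_const_le (R : realType) (I : choiceType) (phi : R -> R) (u : R) :
  Orlicz_function phi -> infinite_set [set: I] -> 0 < u ->
  (char_const (orlicz_heart phi : set (I -> R[i])) (luxemburg phi)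
     <= (1 / u)%:E)%E <-> phi u = 0.
Proof.
move=> phiO infI u0; rewrite char_const_orlicz_inv//.
have term n : (0 < n)%N ->
    (1 / orlicz_inv phi (1 / n%:R) <= 1 / u) = (phi u <= 1 / n%:R).
  move=> n0; have n_gt0 : 0 < n%:R :> R by rewrite ltr0n.
  have [m0 mP] := orlicz_inv_level phiO (divr_gt0 ltr01 n_gt0).
  rewrite mP; last exact: ltW.
  by move: m0; set m := orlicz_inv _ _ => m0; rewrite !mul1r lef_pV2.
split=> [Cu|phiu].
  apply/eqP; rewrite eq_le (orlicz_ge0 phiO (ltW u0)) andbT leNgt.
  apply/negP => phiu.
  (* Archimedean step: [n > 1 / phi u] means [1 / n < phi u], against the bound for this [n]. *)
  have := truncnS_gt (1 / phi u); set n := (_.+1) => un.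
  have : phi u <= 1 / n%:R.
    rewrite -term// -lee_fin; apply: le_trans Cu.
    by apply: ereal_sup_ubound; exists n.
  by rewrite leNgt ltr_pdivrMr ?ltr0n// mulrC -ltr_pdivrMr// un.
apply: ge_ereal_sup => _ [n n0 <-].
by rewrite lee_fin term// phiu divr_ge0.
Qed.

Lemma char_const_gt0 (R : realType) (I : choiceType) (phi : R -> R) :
  Orlicz_function phi -> infinite_set [set: I] ->
  (0 < char_const (orlicz_heart phi : set (I -> R[i])) (luxemburg phi))%E.
Proof.
move=> phiO infI; rewrite char_const_orlicz_inv//.
apply: lt_le_trans (ereal_sup_ubound _); last by exists 1%N.
have [m0 _] := orlicz_inv_level phiO (divr_gt0 ltr01 (ltr0Sn R 0)).
by rewrite lte_fin divr_gt0.
Qed.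

(** A finite [C_E] is a positive real, so [u = 1 / C_E] makes the criterion [C_E <= 1 / u] hold with
    equality, which forces [phi u = 0]. *)
Lemma char_const_lty (R : realType) (I : choiceType) (phi : R -> R) :
  Orlicz_function phi -> infinite_set [set: I] ->
  (char_const (orlicz_heart phi : set (I -> R[i])) (luxemburg phi) < +oo)%E ->
  exists2 u, 0 < u & phi u = 0 /\
  char_const (orlicz_heart phi : set (I -> R[i])) (luxemburg phi)
    = (1 / u)%:E.
Proof.
move=> phiO infI; have := char_const_gt0 phiO infI.
move: (fun u => @char_const_le _ I phi u phiO infI); case: char_const => [c| |]// cP.
rewrite lte_fin => c0 _; exists (1 / c); first by rewrite divr_gt0.
have cE : c%:E = (1 / (1 / c))%:E by rewrite !mul1r invrK.
by split=> //; apply/cP; rewrite -?cE// divr_gt0.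
Qed.

(** Zeros of [phi] lie in [{phi <= 1}], which [phi^{-1}(1)] bounds. *)
Lemma has_sup_orlicz_zeros (R : realType) (phi : R -> R) :
  Orlicz_function phi -> has_sup [set t | 0 <= t /\ phi t = 0].
Proof.
move=> phiO; split; first by exists 0; split=> //; exact: orlicz0.
have [_ mP] := orlicz_inv_level phiO ltr01.
by exists (orlicz_inv phi 1) => t [t0 phit]; rewrite -mP// phit.
Qed.

Lemma orlicz_a_gt0P (R : realType) (phi : R -> R) :
  Orlicz_function phi -> 0 < orlicz_a phi <-> exists2 u, 0 < u & phi u = 0.
Proof.
move=> phiO; split=> [a0|[u u0 phiu]]; last first.
  apply: (lt_le_trans u0); apply: sup_upper_bound => //.
    exact: has_sup_orlicz_zeros.
  by split=> //; exact: ltW.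
(* With the supremum itself as tolerance, the zero [t] obtained exceeds [a - a = 0]. *)
have [t [_ phit] at0] := sup_adherent a0 (has_sup_orlicz_zeros phiO).
by exists t => //; rewrite subrr in at0.
Qed.

(** For each [s > 0] all zeros lie below [phi^{-1}(s)], hence so does their supremum, and [phi] is
    at most [s] there. *)
Lemma orlicz_a_zero (R : realType) (phi : R -> R) :
  Orlicz_function phi -> phi (orlicz_a phi) = 0.
Proof.
move=> phiO; have [Z0 Zub] := has_sup_orlicz_zeros phiO.
have a_ge0 : 0 <= orlicz_a phi.
  by apply: ub_le_sup => //; split=> //; exact: orlicz0.
apply/eqP; rewrite eq_le (orlicz_ge0 phiO)// andbT.
apply/ler_addgt0Pr => s s0; rewrite add0r.
have [_ mP] := orlicz_inv_level phiO s0.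
rewrite mP//; apply: ge_sup => // t [t0 phit].
by rewrite -mP// phit ltW.
Qed.

(** By monotonicity one positive zero [u] makes [phi] vanish on [[0, u]]. The guard [0 <= t] is
    there because neighbourhoods of [0] in [R] contain negative points, where [phi] is
    unconstrained. *)
Lemma near0_orlicz_zeroP (R : realType) (phi : R -> R) :
  Orlicz_function phi ->
  (\forall t \near 0, 0 <= t -> phi t = 0) <-> exists2 u, 0 < u & phi u = 0.
Proof.
move=> phiO; split=> [/nbhs_ballP[e /= e0 he]|[u u0 phiu]].
  exists (e / 2); first by rewrite divr_gt0.
  apply: he; last by rewrite divr_ge0 ?ltW.
  rewrite /ball/= sub0r normrN gtr0_norm ?divr_gt0//.
  by rewrite ltr_pdivrMr// ltr_pMr// ltr1n.
near=> t => t0; apply/eqP; rewrite eq_le (orlicz_ge0 phiO)// andbT -phiu.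
apply: (orlicz_nondecreasing phiO); rewrite ?in_itv/= ?andbT// ?(ltW u0)//.
by near: t; exact: nbhs0_ltW.
Unshelve. all: by end_near. Qed.

Theorem proposition5p8 (R : realType) (I : choiceType)
    (I_neq0 : [set: I] !=set0) (phi : R -> R) (phiO : Orlicz_function phi) :
  let E : set (I -> R[i]) := orlicz_heart phi in
  let C_E : \bar R := char_const E (luxemburg phi) in
  [/\
      forall i : I,
        luxemburg phi (\1_[set i] : I -> R[i]) = (1 / orlicz_inv phi 1)%:E,
     
      forall (F : set I) (n : nat), (0 < n)%N -> (F #= `I_n)%card ->
        luxemburg phi (\1_F : I -> R[i]) = (1 / orlicz_inv phi (1 / n%:R))%:E,
      infinite_set [set: I] ->
        [/\ C_E = ereal_sup [set luxemburg phi (\1_F : I -> R[i]) |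
                             F in [set F | finite_set F]],
            C_E = ereal_sup [set (1 / orlicz_inv phi (1 / n%:R))%:E |
                             n in [set n : nat | (0 < n)%N]]
          & (0 < C_E)%E]
    &
      infinite_set [set: I] ->
        [/\ (C_E < +oo)%E <-> (\forall t \near 0, 0 <= t -> phi t = 0),
            (\forall t \near 0, 0 <= t -> phi t = 0) <-> 0 < orlicz_a phi,
            0 < orlicz_a phi -> C_E = (1 / orlicz_a phi)%:E,
            (forall t, 0 < t -> 0 < phi t) -> C_E = +oo%E
          & N_function phi -> C_E = +oo%E]].
Proof.
move=> E C_E.
have zeros0 : (forall t, 0 < t -> 0 < phi t) ->
    ~ exists2 u, 0 < u & phi u = 0.
  by move=> phi_gt0 [u /phi_gt0 + phiu]; rewrite phiu ltxx.
split=> [i|F n n0 Fn|infI|infI].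
- by rewrite (luxemburg_indic phiO _ card_set1)// divr1.
- exact: luxemburg_indic.
- split; [exact: char_const_orlicz_heart|exact: char_const_orlicz_inv|].
  exact: char_const_gt0.
(* The existence of a positive zero is the pivot to which all the conditions in (c) are reduced. *)
- have ltyP : (C_E < +oo)%E <-> exists2 u, 0 < u & phi u = 0.
    split=> [/(char_const_lty phiO infI)[u u0 [phiu _]]|[u u0 phiu]].
      by exists u.
    by apply: le_lt_trans (ltry (1 / u)); apply/char_const_le.
  have C_Ey : (forall t, 0 < t -> 0 < phi t) -> C_E = +oo%E.
    move=> /zeros0 no_zero; apply/eqP; rewrite -leye_eq leNgt.
    by apply/negP => /ltyP.
  split=> //.
  + by rewrite ltyP near0_orlicz_zeroP.
  + by rewrite near0_orlicz_zeroP// orlicz_a_gt0P.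
  (* As [a_phi] is itself a zero, [C_E <= 1 / a_phi]. Conversely [C_E = 1 / u] for some positive
     zero [u], and [u <= a_phi]. *)
  + move=> a0; apply/eqP; rewrite eq_le; apply/andP; split.
      by apply/char_const_le => //; exact: orlicz_a_zero.
    have /ltyP/(char_const_lty phiO infI)[u u0 [phiu]] :=
      (orlicz_a_gt0P phiO).1 a0.
    rewrite /C_E => ->; rewrite lee_fin !mul1r lef_pV2//; apply: sup_upper_bound.
      exact: has_sup_orlicz_zeros.
    by split=> //; exact: ltW.
  + by move=> phiN; apply: C_Ey => t; exact: N_function_gt0.
Qed.
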